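(* Let $X$ and $Y$ be compact Hausdorff spaces. Let $0<\epsilon<1/4$. Assume that $Y$ has at least two points, and that $X$ is finite with at least two points. Then there exists an $\epsilon$-disjointness preserving operator $T:C(X)\to C(Y)$ with $\|T\|=1$ such that there is no weighted composition map $S:C(X)\to C(Y)$ with $\|T-S\|<o'_X(\epsilon)$.
   Context: $\mathbb{K}$ denotes $\mathbb{R}$ or $\mathbb{C}$. For a compact Hausdorff space $Z$, $C(Z)$ is the Banach space of $\mathbb{K}$-valued continuous functions on $Z$ with the sup norm $\|\cdot\|_\infty$; norms of operators are operator norms. For $\epsilon>0$, an operator $T:C(X)\to C(Y)$ is $\epsilon$-disjointness preserving if it is linear, continuous, and $\|(Tf)(Tg)\|_\infty\le\epsilon$ whenever $f,g\in C(X)$ satisfy $\|f\|_\infty=\|g\|_\infty=1$ and $fg\equiv 0$. An operator $S:C(X)\to C(Y)$ is a weighted composition map if there exist $a\in C(Y)$ and a map $h:Y\to X$, continuous on $c(a):=\{y\in Y:a(y)\ne 0\}$, such that $(Sf)(y)=a(y)f(h(y))$ for every $f\in C(X)$ and $y\in Y$ (the case $S\equiv 0$ is included). For $n\in\mathbb{N}$ put $\omega_n:=\frac{n^2-1}{4n^2}$. For a finite set $X$ with $n\ge 2$ points, $o'_X:(0,1/4)\to\mathbb{R}$ is defined by: $o'_X(\epsilon):=2\sqrt{\frac{(n-1)\epsilon}{n+1}}$ if $n$ is odd and $\epsilon\le\omega_n$; $o'_X(\epsilon):=\frac{n-1}{n}$ if $n$ is odd and $\epsilon>\omega_n$; $o'_X(\epsilon):=\frac{2(n-1)\sqrt{\epsilon}}{n}$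 if $n$ is even. *)

(* Defs.v *)
From HB Require Import structures.
From mathcomp Require Import all_boot all_order all_algebra.
From mathcomp Require Import complex.
From mathcomp Require Import mathcomp_extra boolp classical_sets functions.
From mathcomp Require Import cardinality reals topology normedtype.

Set Implicit Arguments.
Unset Strict Implicit.
Unset Printing Implicit Defensive.

Import Order.TTheory GRing.Theory Num.Theory.
Import numFieldNormedType.Exports.
Local Open Scope classical_set_scope.
Local Open Scope ring_scope.

HB.mixin Record isCompactHausdorff T & Topological T := {
  compactT : compact [set: T];
  hausdorffT : hausdorff_space T
}.

#[short(type="compactHausdorffType")]
HB.structure Definition CompactHausdorff :=
  {T of isCompactHausdorff T & Topological T}.

Inductive scalars := RealScalars | ComplexScalars.

Definition scalar_field (R : realType) (k : scalars) : numFieldType :=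
  match k with
  | RealScalars => R
  | ComplexScalars => R[i]
  end.

(* The norm of a numFieldType takes values in the field itself, so the norm of
   R[i] takes values in R[i]; modulus is the same quantity as an element of R
   (see of_real_modulus below). *)
Definition modulus (R : realType) (k : scalars) : scalar_field R k -> R :=
  match k with
  | RealScalars => fun z : R => `|z|
  | ComplexScalars => fun z : R[i] => complex.Re `|z|
  end.

Definition of_real (R : realType) (k : scalars) : R -> scalar_field R k :=
  match k with
  | RealScalars => fun x : R => x
  | ComplexScalars => fun x : R => real_complex R x
  end.

Definition supnorm (R : realType) (k : scalars) (Z : Type)
    (f : Z -> scalar_field R k) : R :=
  sup (range (fun z => modulus (f z))).

Definition ctsfun (R : realType) (k : scalars) (Z : topologicalType) :=
  continuousType Z (scalar_field R k).

Section modulus_theory.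
Variables (R : realType) (k : scalars).
Local Notation K := (scalar_field R k).
Implicit Types (x y : R) (z w : K).

Lemma of_real_modulus z : of_real k (modulus z) = `|z|.
Proof.
by case: k z => //= z; rewrite -[LHS]/(real_complex R _) normc_def.
Qed.

Lemma ler_of_real x y : (of_real k x <= of_real k y) = (x <= y).
Proof. by case: k => //=; rewrite lecR. Qed.

Lemma ltr_of_real x y : (of_real k x < of_real k y) = (x < y).
Proof. by case: k => //=; rewrite ltcR. Qed.

Lemma of_realD x y : of_real k (x + y) = of_real k x + of_real k y.
Proof. by case: k => //=; exact: rmorphD. Qed.

Lemma of_realM x y : of_real k (x * y) = of_real k x * of_real k y.
Proof. by case: k => //=; exact: rmorphM. Qed.

Lemma of_real0 : of_real k 0 = 0 :> K.
Proof. by case: k => //=; exact: rmorph0. Qed.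

Lemma of_real_inj : injective (@of_real R k).
Proof. by move=> x y xy; apply/eqP; rewrite eq_le -!ler_of_real xy lexx. Qed.

Lemma modulus_ge0 z : 0 <= modulus z.
Proof. by rewrite -ler_of_real of_real0 of_real_modulus. Qed.

Lemma modulus0_eq0 z : modulus z = 0 -> z = 0.
Proof. by move=> z0; apply/normr0_eq0; rewrite -of_real_modulus z0 of_real0. Qed.

Lemma ler_modulusD z w : modulus (z + w) <= modulus z + modulus w.
Proof. by rewrite -ler_of_real of_realD !of_real_modulus ler_normD. Qed.

Lemma modulusM z w : modulus (z * w) = modulus z * modulus w.
Proof. by apply: of_real_inj; rewrite of_realM !of_real_modulus normrM. Qed.

Lemma modulusN z : modulus (- z) = modulus z.
Proof. by apply: of_real_inj; rewrite !of_real_modulus normrN. Qed.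

Lemma modulus_continuous : continuous (@modulus R k).
Proof.
move=> z; have Fz : Filter (nbhs z) by exact: nbhs_filter.
apply/(@cvgrPdist_lt R R^o) => e e0.
have : \forall w \near z, `|z - w| < of_real k e.
  apply/(@nbhs_normP K K^o); exists (of_real k e) => //=.
  by rewrite -of_real0 ltr_of_real.
apply: filterS => w; rewrite -of_real_modulus ltr_of_real; apply: le_lt_trans.
rewrite ler_norml; apply/andP; split.
  rewrite lerNl opprB lerBlDr -(modulusN (z - w)) opprB.
  by rewrite -[in leLHS](subrK z w) ler_modulusD.
by rewrite lerBlDr -[in leLHS](subrK w z) ler_modulusD.
Qed.

End modulus_theory.

Section ctsfun_lmodType.
Variables (R : realType) (k : scalars) (Z : topologicalType).
Local Notation K := (scalar_field R k).
Local Notation C := (ctsfun R k Z).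
Implicit Types f g h : C.

HB.instance Definition _ := Choice.on C.

Fact cst0_continuous : continuous (fun _ : Z => 0 : K).
Proof. by move=> z; exact: cvg_cst. Qed.

Fact add_fun_continuous f g : continuous (fun z => f z + g z).
Proof. by move=> z; apply: cvgD; exact: cts_fun. Qed.

Fact opp_fun_continuous f : continuous (fun z => - f z).
Proof. by move=> z; apply: cvgN; exact: cts_fun. Qed.

Fact scale_fun_continuous (a : K) f : continuous (fun z => a * f z).
Proof. by move=> z; apply: cvgM; [exact: cvg_cst|exact: cts_fun]. Qed.

Definition ctsfun0 : C := mkcts (@cst0_continuous).
Definition ctsfunD f g : C := mkcts (@add_fun_continuous f g).
Definition ctsfunN f : C := mkcts (@opp_fun_continuous f).
Definition ctsfunZ (a : K) f : C := mkcts (@scale_fun_continuous a f).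

Fact ctsfunDA : associative ctsfunD.
Proof. by move=> f g h; apply/continuousEP => z; exact: addrA. Qed.

Fact ctsfunDC : commutative ctsfunD.
Proof. by move=> f g; apply/continuousEP => z; exact: addrC. Qed.

Fact ctsfun0D : left_id ctsfun0 ctsfunD.
Proof. by move=> f; apply/continuousEP => z; exact: add0r. Qed.

Fact ctsfunND : left_inverse ctsfun0 ctsfunN ctsfunD.
Proof. by move=> f; apply/continuousEP => z; exact: addNr. Qed.

HB.instance Definition _ :=
  GRing.isZmodule.Build C ctsfunDA ctsfunDC ctsfun0D ctsfunND.

Fact ctsfunZA a b f : ctsfunZ a (ctsfunZ b f) = ctsfunZ (a * b) f.
Proof. by apply/continuousEP => z; exact: mulrA. Qed.

Fact ctsfunZ1 : left_id 1 ctsfunZ.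
Proof. by move=> f; apply/continuousEP => z; exact: mul1r. Qed.

Fact ctsfunZDr : right_distributive ctsfunZ +%R.
Proof. by move=> a f g; apply/continuousEP => z; exact: mulrDr. Qed.

Fact ctsfunZDl f : {morph ctsfunZ^~ f : a b / a + b}.
Proof. by move=> a b; apply/continuousEP => z; exact: mulrDl. Qed.

HB.instance Definition _ :=
  GRing.Zmodule_isLmodule.Build K C ctsfunZA ctsfunZ1 ctsfunZDr ctsfunZDl.

End ctsfun_lmodType.

Section ctsfun_normedModType.
Variables (R : realType) (k : scalars) (Z : compactHausdorffType).
Local Notation K := (scalar_field R k).
Local Notation C := (ctsfun R k Z).
Implicit Types f g : C.

Lemma has_ubound_modulus f : has_ubound (range (fun z => modulus (f z))).
Proof.
have : compact ((fun z => modulus (f z)) @` [set: Z]).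
  apply: continuous_compact; last exact: compactT.
  apply: continuous_subspaceT => z.
  by apply: continuous_comp; [exact: cts_fun|exact: modulus_continuous].
move=> /compact_bounded[M [_ /(_ (M + 1))]].
rewrite ltrDl ltr01 => /(_ isT) ubM; exists (M + 1) => r fr.
exact: le_trans (ler_norm r) (ubM _ fr).
Qed.

Lemma modulus_le_supnorm f (z : Z) : modulus (f z) <= supnorm f.
Proof. by apply: ub_le_sup; [exact: has_ubound_modulus|exists z]. Qed.

Lemma supnorm_ge0 f : 0 <= supnorm f.
Proof.
have [[_ [z _ _]]|] := pselect (range (fun z => modulus (f z)) !=set0).
  exact: le_trans (modulus_ge0 (f z)) (modulus_le_supnorm f z).
by move=> /set0P/negP/negPn/eqP; rewrite /supnorm => ->; rewrite sup0.
Qed.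

Lemma supnorm_le f (c : R) : 0 <= c -> (forall z, modulus (f z) <= c) ->
  supnorm f <= c.
Proof.
move=> c0 fc; have [r0|] := pselect (range (fun z => modulus (f z)) !=set0).
  by apply: ge_sup => // _ [z _ <-].
by move=> /set0P/negP/negPn/eqP; rewrite /supnorm => ->; rewrite sup0.
Qed.

Lemma ler_supnormD f g : supnorm (f + g) <= supnorm f + supnorm g.
Proof.
apply: supnorm_le => [|z]; first by rewrite addr_ge0// supnorm_ge0.
by apply: le_trans (ler_modulusD _ _) _; rewrite lerD// modulus_le_supnorm.
Qed.

Lemma supnormZ (a : K) f : supnorm (a *: f) = modulus a * supnorm f.
Proof.
have le_ b g : supnorm (b *: g) <= modulus b * supnorm g.
  apply: supnorm_le => [|z].
    by rewrite mulr_ge0 ?modulus_ge0 ?supnorm_ge0.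
  by rewrite modulusM ler_wpM2l ?modulus_ge0// modulus_le_supnorm.
apply/eqP; rewrite eq_le le_/=.
have [a0|a0] := eqVneq a 0.
  suff -> : modulus a = 0 by rewrite mul0r supnorm_ge0.
  by apply: (@of_real_inj R k); rewrite of_real_modulus a0 normr0 of_real0.
have aa1 : modulus a * modulus a^-1 = 1.
  rewrite -modulusM divff//; apply: (@of_real_inj R k).
  by rewrite of_real_modulus normr1; case: k.
rewrite -[in leLHS](scale1r f) -(mulVf a0) -scalerA.
apply: (le_trans (ler_wpM2l (modulus_ge0 a) (le_ _ _))).
by rewrite mulrA aa1 mul1r.
Qed.

Lemma supnorm0_eq0 f : supnorm f = 0 -> f = 0.
Proof.
move=> f0; apply/continuousEP => z; apply: modulus0_eq0.
by apply/eqP; rewrite eq_le modulus_ge0 andbT -f0 modulus_le_supnorm.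
Qed.

Let norm f : K := of_real k (supnorm f).

Fact ctsfun_ler_normD f g : norm (f + g) <= norm f + norm g.
Proof. by rewrite -of_realD ler_of_real ler_supnormD. Qed.

Fact ctsfun_normrZ (a : K) f : norm (a *: f) = `|a| * norm f.
Proof. by rewrite -of_real_modulus -of_realM -supnormZ. Qed.

Fact ctsfun_normr0_eq0 f : norm f = 0 -> f = 0.
Proof. by rewrite -(@of_real0 R k) => /of_real_inj /supnorm0_eq0. Qed.

HB.instance Definition _ := Lmodule_isNormed.Build K C
  ctsfun_ler_normD ctsfun_normrZ ctsfun_normr0_eq0.

Lemma ctsfun_normE f : `|f| = of_real k (supnorm f).
Proof. by []. Qed.

End ctsfun_normedModType.

Section operators.
Variables (R : realType) (k : scalars) (X Y : compactHausdorffType).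
Local Notation K := (scalar_field R k).
Local Notation CX := (ctsfun R k X).
Local Notation CY := (ctsfun R k Y).

(* The operator norm for bounded T; continuous linear maps, weighted composition
   maps and their differences are all bounded, so the junk value sup = 0 of an
   unbounded set does not arise. *)
Definition opnorm (T : CX -> CY) : R :=
  sup [set supnorm (T f) | f in [set f : CX | supnorm f <= 1]].

Definition eps_disjointness_preserving (eps : R) (T : CX -> CY) : Prop :=
  [/\ linear T, continuous T &
      forall f g : CX, supnorm f = 1 -> supnorm g = 1 ->
        (forall x, f x * g x = 0) ->
        supnorm (fun y => T f y * T g y) <= eps].

Definition weighted_composition_map (S : CX -> CY) : Prop :=
  exists (a : CY) (h : Y -> X),
    {within [set y | a y != 0], continuous h} /\
    forall (f : CX) (y : Y), S f y = a y * f (h y).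

End operators.

Definition omega (R : realType) (n : nat) : R :=
  (n%:R ^+ 2 - 1) / (4 * n%:R ^+ 2).

(* The function depends on the finite set X only through its number n of points. *)
Definition o' (R : realType) (n : nat) (eps : R) : R :=
  if odd n then
    if eps <= omega R n then 2 * Num.sqrt ((n%:R - 1) * eps / (n%:R + 1))
    else (n%:R - 1) / n%:R
  else 2 * (n%:R - 1) * Num.sqrt eps / n%:R.

(* Main.v *)
(* T interpolates, through a Urysohn function, between s times the mean
   functional at one point of Y and the evaluation at a point of X at another;
   in between, T passes through 0, so that disjointness only has to be checked
   for the mean.  If f and g are disjoint, with supports of p and q points, then
   |mean f| |mean g| <= p q / n^2, which is at most 1/4 for even n and at most
   omega_n for odd n; s <= 1 is taken as large as this allows.  A weighted
   composition map sees a single point of X, hence misses s (n - 1) / n of the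
   mass of s times the mean; the evaluation ensures that T has norm 1. *)
Require Import Defs.
From mathcomp Require Import all_boot all_order all_algebra.
From mathcomp Require Import boolp classical_sets functions.
From mathcomp Require Import cardinality reals topology normedtype.
From mathcomp Require Import complex.
From mathcomp Require Import ring lra zify.

Import Order.TTheory GRing.Theory Num.Theory.
Import numFieldNormedType.Exports.
Local Open Scope classical_set_scope.
Local Open Scope card_scope.
Local Open Scope ring_scope.

(** * The weight of the mean functional *)

Section uniform_mass.
Variables (R : realType) (n : nat) (eps : R).
Hypotheses (n2 : (2 <= n)%N) (eps01 : 0 < eps < 1 / 4).

(** In each branch, the largest s in [0, 1] with s^2 c <= eps, where c bounds pq / n^2: it is
    omega_n for odd n and 1/4 for even n. *)
Definition uniform_mass : R :=
  if odd n then
    if eps <= omega R n then Num.sqrt (eps / omega R n) else 1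
  else 2 * Num.sqrt eps.

Let n2R : 2 <= n%:R :> R. Proof. by rewrite ler_nat. Qed.
Let n0R : n%:R != 0 :> R. Proof. by move: n2R; case: eqP => // ->; lra. Qed.

Lemma omega_gt0 : 0 < omega R n.
Proof. by rewrite /omega divr_gt0//; move: n2R; nra. Qed.

Lemma uniform_mass_ge0 : 0 <= uniform_mass.
Proof.
by rewrite /uniform_mass; do 2?case: ifP => _; rewrite ?mulr_ge0 ?sqrtr_ge0.
Qed.

Lemma uniform_mass_le1 : uniform_mass <= 1.
Proof.
rewrite /uniform_mass; case: ifP => _; [case: ifP => // le_eps|].
  by rewrite -sqrtr1 ler_wsqrtr// ler_pdivrMr ?omega_gt0// mul1r.
have /andP[e0 e4] := eps01.
rewrite -(@ler_pXn2r _ 2) ?nnegrE ?mulr_ge0 ?sqrtr_ge0//.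
by rewrite exprMn sqr_sqrtr ?(ltW e0)//; move: e4; lra.
Qed.

(** As 4pq = (p + q)^2 - (p - q)^2, always 4pq <= n^2. For odd n the bound improves to n^2 - 1: if p
    + q = n then p and q differ, and otherwise 4pq <= (n - 1)^2. *)
Lemma uniform_mass_split (p q : nat) : (p + q <= n)%N ->
  uniform_mass ^+ 2 * (p%:R * q%:R) <= n%:R ^+ 2 * eps.
Proof.
move=> pqn; have /andP[e0 e4] := eps01.
have N0 : 0 < 4 * n%:R ^+ 2 :> R by move: n2R; nra.
rewrite /uniform_mass; case: ifP => odd_n.
  have pq4 : 4 * (p%:R * q%:R) <= n%:R ^+ 2 - 1 :> R.
    rewrite lerBrDr -!natrM -natrX natr1 ler_nat.
    (* Parity is turned into an equation that [nia] can use. *)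
    have [m nE] : exists m, n = m.*2.+1.
      by exists n./2; rewrite -[LHS]odd_double_half odd_n.
    have [pq|pq] := leqP p q; nia.
  case: (leP eps (omega R n)) => le_eps.
    rewrite (sqr_sqrtr (divr_ge0 (ltW e0) (ltW omega_gt0))).
    rewrite mulrAC ler_pdivrMr ?omega_gt0// [leRHS]mulrAC [leRHS]mulrC.
    rewrite ler_wpM2l ?(ltW e0)// /omega.
    have -> : n%:R ^+ 2 * ((n%:R ^+ 2 - 1) / (4 * n%:R ^+ 2)) =
              (n%:R ^+ 2 - 1) / 4 :> R by field.
    by move: pq4; lra.
  move: le_eps; rewrite /omega ltr_pdivrMr// expr1n mul1r.
  by move: pq4; lra.
rewrite exprMn sqr_sqrtr ?(ltW e0)// mulrAC ler_wpM2r ?(ltW e0)//.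
rewrite -!natrM -!natrX -natrM ler_nat.
by rewrite (leq_trans (nat_AGM2 p q))// leq_exp2r.
Qed.

(** For odd n and small eps both sides are nonnegative, and both squares equal 4 eps (n - 1) / (n +
    1). *)
Lemma uniform_massE : uniform_mass * ((n%:R - 1) / n%:R) = o' n eps.
Proof.
have /andP[e0 e4] := eps01.
rewrite /uniform_mass /o'; case: ifP => _; last by field.
case: ifP => _; last by rewrite mul1r.
apply/eqP; rewrite -(@eqrXn2 _ 2) ?mulr_ge0 ?sqrtr_ge0 ?invr_ge0//; last first.
  by move: n2R; lra.
rewrite !exprMn (sqr_sqrtr (divr_ge0 (ltW e0) (ltW omega_gt0))) sqr_sqrtr.
  rewrite /omega; apply/eqP; field.
  by do ?[apply/andP; split] => //; apply: lt0r_neq0; move: n2R; nra.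
by rewrite divr_ge0 ?mulr_ge0 ?(ltW e0)//; move: n2R; lra.
Qed.

End uniform_mass.

(** * Real scalars in [K] and the modulus *)

Section scalars_theory.
Variables (R : realType) (k : scalars).
Local Notation K := (scalar_field R k).

Lemma of_real1 : of_real k 1 = 1 :> K.
Proof. by case: k => //=; exact: rmorph1. Qed.

Lemma of_realB (x y : R) : of_real k (x - y) = of_real k x - of_real k y :> K.
Proof. by case: k => //=; exact: rmorphB. Qed.

Lemma of_real_nat m : of_real k m%:R = m%:R :> K.
Proof. by case: k => //=; exact: rmorph_nat. Qed.

Lemma modulus_of_real (x : R) : modulus (of_real k x) = `|x|.
Proof.
by case: k => //=; rewrite expr0n addr0 sqrtr_sqr.
Qed.

Lemma modulus0 : modulus (0 : K) = 0.
Proof. by rewrite -of_real0 modulus_of_real normr0. Qed.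

Lemma modulus1 : modulus (1 : K) = 1.
Proof. by rewrite -of_real1 modulus_of_real normr1. Qed.

Lemma modulus_sum (I : Type) (r : seq I) (P : pred I) (F : I -> K) :
  modulus (\sum_(i <- r | P i) F i) <= \sum_(i <- r | P i) modulus (F i).
Proof.
elim/big_ind2 : _ => [|x a y b xa yb|//]; first by rewrite modulus0.
by rewrite (le_trans (ler_modulusD _ _))// lerD.
Qed.

Lemma of_real_continuous : continuous (of_real k : R -> K).
Proof.
move=> x; have Fx : Filter (nbhs x) by exact: nbhs_filter.
apply/(@cvgrPdist_lt K K^o) => e e0.
(* A positive element of [K] is real, also when [K] is [R[i]]. *)
have eE : e = of_real k (modulus e) by rewrite of_real_modulus gtr0_norm.
have me0 : 0 < modulus e by rewrite -(@ltr_of_real R k) -eE of_real0.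
apply/(@nbhs_normP R R^o); exists (modulus e) => //= y.
by rewrite -of_realB -of_real_modulus modulus_of_real eE ltr_of_real -eE.
Qed.

End scalars_theory.

(** * The mean functional over finitely many points *)

Section finite_mean.
Variables (R : realType) (k : scalars) (X : compactHausdorffType).
Variables (n : nat) (e : 'I_n -> X).
Local Notation K := (scalar_field R k).
Implicit Types f g : ctsfun R k X.

Definition finite_mean f : K := of_real k n%:R^-1 * \sum_i f (e i).

Lemma finite_meanP (a : K) f g :
  finite_mean (a *: f + g) = a * finite_mean f + finite_mean g.
Proof.
rewrite /finite_mean mulrCA -mulrDr; congr (_ * _).
by rewrite mulr_sumr -big_split; apply: eq_bigr.
Qed.

(** Only the indices where [f] does not vanish contribute, each at most [supnorm f]. Keeping their
    number is what lets disjointness enter later. *)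
Lemma modulus_finite_mean f :
  modulus (finite_mean f) <=
    supnorm f * (#|[pred i | f (e i) != 0]|%:R / n%:R).
Proof.
rewrite /finite_mean modulusM modulus_of_real ger0_norm ?invr_ge0//.
rewrite mulrA [leRHS]mulrC ler_wpM2l ?invr_ge0//.
apply: (le_trans (modulus_sum _ _ _ _ _ _)).
rewrite (bigID [pred i | f (e i) != 0])/= addrC big1 => [|i]; last first.
  by rewrite negbK => /eqP ->; rewrite modulus0.
rewrite add0r mulr_natr -sumr_const.
by apply: ler_sum => i _; exact: modulus_le_supnorm.
Qed.

Lemma modulus_finite_mean_le f : modulus (finite_mean f) <= supnorm f.
Proof.
apply: (le_trans (modulus_finite_mean f)).
rewrite -[leRHS]mulr1 ler_wpM2l ?supnorm_ge0//.
(* For [n = 0] the quotient is 0, because the inverse of 0 is 0 by convention. *)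
have [n0|n0] := posnP n; first by rewrite [X in _ / X%:R]n0 invr0 mulr0.
by rewrite ler_pdivrMr ?ltr0n// mul1r ler_nat -[leqRHS]card_ord max_card.
Qed.

End finite_mean.
Arguments finite_mean {R k X n} e f.

(** * Discreteness of finite Hausdorff spaces and separation of points *)

Lemma finite_hausdorff_continuous (X U : topologicalType) (g : X -> U) :
  hausdorff_space X -> finite_set [set: X] -> continuous g.
Proof.
move=> hX finX x A /nbhs_singleton Agx.
(* The complement of a point is finite, hence closed. *)
have ox : open [set x].
  rewrite -[X in open X]setCK; apply: closed_openC.
  have := hausdorff_accessible hX; rewrite accessible_finite_set_closed; apply.
  exact: sub_finite_set finX.
by apply: filterS (open_nbhs_nbhs (conj ox erefl)) => _ ->.
Qed.

(** For a Urysohn function [u], the positive parts of 1 - 2u and 2u - 1 have product 0, since these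
    functions are opposite, and sum |2u - 1| <= 1. *)
Lemma disjoint_bumps (R : realType) (Y : compactHausdorffType) (y1 y2 : Y) :
  y1 <> y2 -> exists al be : Y -> R,
    [/\ continuous al /\ continuous be,
        forall y, [/\ 0 <= al y, 0 <= be y, al y * be y = 0 & al y + be y <= 1],
        al y1 = 1 & be y2 = 1].
Proof.
move=> y12.
have cl1 : forall y : Y, closed [set y].
  exact: accessible_closed_set1 (hausdorff_accessible hausdorffT).
have y12_0 : [set y1] `&` [set y2] = set0.
  by rewrite -subset0 => y [-> /y12].
have [u [cu u01 u0 u1]] : exists u : Y -> R, [/\ continuous u,
    range u `<=` `[0, 1], u @` [set y1] `<=` [set 0] &
    u @` [set y2] `<=` [set 1]].
  apply/uniform_separatorP; apply: normal_uniform_separator => //.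
  exact: compact_normal hausdorffT compactT.
exists (fun y => Num.max 0 (1 - 2 * u y)), (fun y => Num.max 0 (2 * u y - 1)).
have cu2 : continuous (fun y => 2 * u y).
  by move=> y; apply: cvgM; [exact: cvg_cst|exact: cu].
split.
- split=> y; apply: (@continuous_max R Y); try exact: cvg_cst.
    by apply: cvgB; [exact: cvg_cst|exact: cu2].
  by apply: cvgB; [exact: cu2|exact: cvg_cst].
- move=> y; have /u01 : range u (u y) by exists y.
  rewrite /= in_itv/= => /andP[uy0 uy1]; rewrite !le_max !lexx.
  by case: (leP 0 (1 - 2 * u y)); case: (leP 0 (2 * u y - 1)) => *;
    split=> //; nra.
- have -> : u y1 = 0 by apply: u0; exists y1.
  by rewrite mulr0 subr0; apply/max_idPr.
- have -> : u y2 = 1 by apply: u1; exists y2.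
  by rewrite mulr1 -natr1 addrK; apply/max_idPr.
Qed.

(** * Operator norms and contractions *)

Section operator_norm.
Variables (R : realType) (k : scalars) (X Y : compactHausdorffType).
Local Notation CX := (ctsfun R k X).
Local Notation CY := (ctsfun R k Y).
Implicit Types T S : CX -> CY.

(** The bound [M] ensures that the supremum is a genuine one, not the default 0 of an unbounded
    set. *)
Lemma supnorm_le_opnorm T (M : R) (f : CX) :
  (forall g : CX, supnorm g <= 1 -> supnorm (T g) <= M) -> supnorm f <= 1 ->
  supnorm (T f) <= opnorm T.
Proof.
move=> TM f1; apply: ub_le_sup; last by exists f.
by exists M => _ [g g1 <-]; exact: TM.
Qed.

Lemma contraction_continuous T :
  linear T -> (forall f : CX, supnorm (T f) <= supnorm f) -> continuous T.
Proof.
move=> linT leT f; have Ff : Filter (nbhs f) by exact: nbhs_filter.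
apply/cvgrPdist_lt => e e0; apply/(@nbhs_normP (scalar_field R k) CX).
exists e => //= g.
apply: le_lt_trans.
have -> : T f - T g = T (f - g).
  by rewrite addrC -scaleN1r -linT scaleN1r addrC.
by rewrite !ctsfun_normE ler_of_real.
Qed.

End operator_norm.

(** * The interpolating operator and its distance to weighted composition maps *)

Section bump_operator.
Variables (R : realType) (k : scalars) (X Y : compactHausdorffType).
Variables (n : nat) (e : 'I_n -> X) (x0 : X) (s : R) (al be : Y -> R).
Hypotheses (al_cont : continuous al) (be_cont : continuous be).
Hypothesis s01 : 0 <= s <= 1.
Hypothesis al_be : forall y,
  [/\ 0 <= al y, 0 <= be y, al y * be y = 0 & al y + be y <= 1].
Local Notation K := (scalar_field R k).
Local Notation CX := (ctsfun R k X).
Local Notation CY := (ctsfun R k Y).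

Lemma bump_operator_continuous (f : CX) : continuous
  (fun y => of_real k (al y) * (of_real k s * finite_mean e f) +
            of_real k (be y) * f x0 : K).
Proof.
have bump_cont (b : Y -> R) : continuous b ->
    continuous (fun y => of_real k (b y) : K).
  move=> cb y.
  by apply: continuous_comp; [exact: cb|exact: of_real_continuous].
move=> y; apply: cvgD; apply: cvgM; try exact: cvg_cst; exact: bump_cont.
Qed.

Definition bump_operator (f : CX) : CY := mkcts (bump_operator_continuous f).

Lemma bump_operatorE f y : bump_operator f y =
  of_real k (al y) * (of_real k s * finite_mean e f) + of_real k (be y) * f x0.
Proof. by []. Qed.

Lemma bump_operator_linear : linear bump_operator.
Proof.
move=> a f g; apply/continuousEP => y.
rewrite -[RHS]/(a * bump_operator f y + bump_operator g y) !bump_operatorE.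
rewrite finite_meanP -[(a *: f + g) x0]/(a * f x0 + g x0).
ring.
Qed.

(** Each value combines a mean and a value of [f] with nonnegative weights [al y * s] and [be y], of
    sum at most 1. *)
Lemma supnorm_bump_operator (f : CX) : supnorm (bump_operator f) <= supnorm f.
Proof.
apply: supnorm_le => [|y]; first exact: supnorm_ge0.
have /andP[s0 s1] := s01; have [al0 be0 _ ab1] := al_be y.
apply: (le_trans (ler_modulusD _ _)).
move: (finite_mean e f) (modulus_finite_mean_le _ _ _ _ e f) => m mf.
rewrite !modulusM !modulus_of_real !ger0_norm//.
apply: (@le_trans _ _ (al y * (1 * supnorm f) + be y * supnorm f)).
  apply: lerD; last by rewrite ler_wpM2l// modulus_le_supnorm.
  by rewrite ler_wpM2l// ler_pM ?modulus_ge0.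
by rewrite mul1r -mulrDl -[leRHS]mul1r ler_wpM2r ?supnorm_ge0.
Qed.

Lemma bump_operator_disjointness (eps : R) : (0 < n)%N -> 0 <= eps ->
  (forall p q : nat, (p + q <= n)%N ->
     s ^+ 2 * (p%:R * q%:R) <= n%:R ^+ 2 * eps) ->
  eps_disjointness_preserving eps bump_operator.
Proof.
move=> n0 eps0 s_split; split; first exact: bump_operator_linear.
  exact: contraction_continuous bump_operator_linear supnorm_bump_operator.
move=> f g f1 g1 fg0.
(* [supnorm_le] speaks of bundled continuous functions, so the product is bundled first. *)
have prod_cont : continuous
    (fun y => bump_operator f y * bump_operator g y : K).
  by move=> y; apply: cvgM; exact: cts_fun.
apply: (@supnorm_le _ _ _ (mkcts prod_cont)) => // y.
have /andP[s0 s1] := s01; have [al0 be0 /eqP ab0 ab1] := al_be y.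
rewrite -[X in modulus X]/(bump_operator f y * bump_operator g y).
rewrite !bump_operatorE; move: ab0; rewrite mulf_eq0 => /orP[|] /eqP ->.
  (* Where [al y = 0], the product has the factor [f x0 * g x0 = 0]; where [be y = 0], only the
     means remain. *)
  by rewrite of_real0 !mul0r !add0r mulrACA fg0 mulr0 modulus0.
rewrite of_real0 !mul0r !addr0.
pose p := #|[pred i | f (e i) != 0]|; pose q := #|[pred i | g (e i) != 0]|.
(* No index counts for both [f] and [g], as their product vanishes. *)
have pq : (p + q <= n)%N.
  rewrite /p /q -cardUI [X in (_ + X)%N]eq_card0 => [|i]; last first.
    rewrite !inE; apply/negbTE; rewrite negb_and !negbK -mulf_eq0.
    by rewrite fg0.
  by rewrite addn0 -[leqRHS]card_ord max_card.
have /= mf := modulus_finite_mean _ _ _ _ e f.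
have /= mg := modulus_finite_mean _ _ _ _ e g.
rewrite f1 mul1r -/p in mf; rewrite g1 mul1r -/q in mg.
move: (finite_mean e f) (finite_mean e g) mf mg => a b mf mg.
rewrite !modulusM !modulus_of_real !ger0_norm//.
have nR : 0 < n%:R ^+ 2 :> R by rewrite exprn_gt0// ltr0n.
have ab_le : s ^+ 2 * (modulus a * modulus b) <= eps.
  rewrite -(ler_pM2l nR); apply: le_trans (s_split _ _ pq).
  rewrite mulrCA ler_wpM2l ?sqr_ge0//.
  rewrite expr2 mulrACA ler_pM ?mulr_ge0 ?modulus_ge0//.
    by rewrite mulrC -ler_pdivlMr ?ltr0n.
  by rewrite mulrC -ler_pdivlMr ?ltr0n.
have -> : al y * (s * modulus a) * (al y * (s * modulus b)) =
    al y ^+ 2 * (s ^+ 2 * (modulus a * modulus b)) by ring.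
rewrite (le_trans _ ab_le)// ler_piMl ?mulr_ge0 ?sqr_ge0 ?modulus_ge0//.
by rewrite expr_le1//; move: ab1 be0; lra.
Qed.

(** The contraction bound is attained by the constant 1: where [be y = 1], disjointness forces
    [al y = 0], so the value there is 1. *)
Lemma opnorm_bump_operator : (exists y, be y = 1) -> opnorm bump_operator = 1.
Proof.
move=> [y be1].
have le1 (f : CX) : supnorm f <= 1 -> supnorm (bump_operator f) <= 1.
  by move=> f1; apply: le_trans (supnorm_bump_operator f) f1.
have one_cont : continuous (fun _ : X => 1 : K) by move=> x; exact: cvg_cst.
have one_le1 : supnorm (mkcts one_cont : CX) <= 1.
  by apply: supnorm_le => // x; rewrite -[X in modulus X]/(1 : K) modulus1.
apply/eqP; rewrite eq_le; apply/andP; split.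
  apply: ge_sup => [|_ [f f1 <-]]; last exact: le1.
  by exists (supnorm (bump_operator (mkcts one_cont))), (mkcts one_cont).
apply: le_trans (supnorm_le_opnorm _ _ _ _ _ _ _ le1 one_le1).
apply: le_trans (modulus_le_supnorm _ y).
have [_ _ + _] := al_be y; rewrite bump_operatorE be1 mulr1 => ->.
by rewrite of_real0 mul0r add0r of_real1 mulr1 modulus1.
Qed.

(* At a point where [al = 1], test [T - S] on a function that vanishes at the
   point which [S] evaluates and equals 1 elsewhere. *)
Lemma bump_operator_far (y : Y) (S : CX -> CY) : bijective e -> al y = 1 ->
  weighted_composition_map S ->
  s * ((n%:R - 1) / n%:R) <= opnorm (fun f => bump_operator f - S f).
Proof.
move=> e_bij aly [a [h [_ SE]]].
have finX : finite_set [set: X].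
  rewrite -(_ : range e = [set: X]); first exact: finite_image.
  by apply/seteqP; split=> // x _; case: e_bij => e' _ eK; exists (e' x).
pose f0 x : K := of_real k (x != h y)%:R.
have f0_cont : continuous f0 by exact: finite_hausdorff_continuous hausdorffT _.
pose f : CX := mkcts f0_cont.
have f1 : supnorm f <= 1.
  apply: supnorm_le => // x.
  by rewrite modulus_of_real ger0_norm// lern1 leq_b1.
(* A crude bound, so that [opnorm] of the difference is a genuine supremum. *)
have bnd (g : CX) : supnorm g <= 1 ->
    supnorm (bump_operator g - S g) <= 1 + supnorm a.
  move=> g1; apply: supnorm_le => [|z]; first by rewrite addr_ge0// supnorm_ge0.
  apply: (le_trans (ler_modulusD _ _)); apply: lerD.
    apply: le_trans (modulus_le_supnorm _ z) _.
    exact: le_trans (supnorm_bump_operator g) g1.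
  rewrite modulusN SE modulusM -[leRHS]mulr1.
  rewrite ler_pM ?modulus_ge0 ?modulus_le_supnorm//.
  exact: le_trans (modulus_le_supnorm g _) g1.
apply: le_trans (supnorm_le_opnorm _ _ _ _ _ _ _ bnd f1).
apply: le_trans (modulus_le_supnorm _ y).
have [_ _ + _] := al_be y; rewrite aly mul1r => bey.
(* Exactly one index is sent to [h y]; every other one contributes 1. *)
have sumf : \sum_i f (e i) = of_real k (n%:R - 1).
  case: e_bij => e' eK e'K.
  rewrite -[LHS]/(\sum_i f0 (e i)) (bigD1 (e' (h y)))//=.
  rewrite /f0 e'K eqxx of_real0 add0r.
  rewrite (eq_bigr (fun=> of_real k 1)) => [|i ie]; last first.
    by rewrite -(inj_eq (can_inj e'K)) eK ie.
  rewrite sumr_const cardC1 card_ord of_realB of_real_nat of_real1.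
  by rewrite -subn1 natrB// (leq_ltn_trans _ (ltn_ord (e' (h y)))).
(* Since [f] vanishes at [h y], [S f y = 0] whatever the weight [a]; and [be y = 0] because
   [al y = 1]. *)
have -> : (bump_operator f - S f) y = of_real k (s * ((n%:R - 1) / n%:R)).
  rewrite -[LHS]/(bump_operator f y - S f y) SE bump_operatorE.
  rewrite aly bey /finite_mean sumf -[f (h y)]/(f0 (h y)) /f0 eqxx.
  rewrite of_real0 of_real1 mul0r mulr0 addr0 subr0 mul1r -!of_realM.
  by congr of_real; rewrite [_^-1 * _]mulrC.
by rewrite modulus_of_real ler_norm.
Qed.

End bump_operator.

(** * The operator attached to two points of [Y] *)

Theorem theorem4p1 (R : realType) (k : scalars) (X Y : compactHausdorffType)
    (eps : R) (heps : 0 < eps < 1 / 4)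
    (hY : exists y1 y2 : Y, y1 <> y2)
    (n : nat) (hn : (2 <= n)%N) (hX : [set: X] #= `I_n) :
  exists T : ctsfun R k X -> ctsfun R k Y,
    [/\ eps_disjointness_preserving eps T,
        opnorm T = 1 &
        ~ exists S : ctsfun R k X -> ctsfun R k Y,
            weighted_composition_map S /\
            opnorm (fun f => T f - S f) < o' n eps].
Proof.
have [e e_bij] : exists e : 'I_n -> X, bijective e.
  have /card_set_bijP[g [g_sub g_inj g_surj]] := hX.
  have g_lt x : (g x < n)%N by exact: g_sub.
  have [e ge eg] : bijective (fun x => Ordinal (g_lt x)).
    rewrite -setTT_bijective; split=> // [x y _ _ [gxy]|i _].
      by apply: g_inj; rewrite ?inE.
    by have [x _ gx] := g_surj i (ltn_ord i); exists x => //; exact: val_inj.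
  by exists e; exists (fun x => Ordinal (g_lt x)).
have [y1 [y2 /(disjoint_bumps R)[al [be [[cal cbe] al_be al1 be1]]]]] := hY.
have s01 : 0 <= uniform_mass R n eps <= 1.
  by rewrite uniform_mass_ge0 uniform_mass_le1.
have n0 : (0 < n)%N by exact: ltnW.
(* Any point of [X] would serve for the evaluation; the first in the enumeration is taken. *)
exists (bump_operator R k X Y n e (e (Ordinal n0)) (uniform_mass R n eps)
  al be cal cbe).
split.
- apply: bump_operator_disjointness => //.
    by case/andP: heps => /ltW.
  exact: uniform_mass_split.
- by apply: opnorm_bump_operator => //; exists y2.
- move=> [S [Swc]]; apply/negP; rewrite -leNgt -uniform_massE//.
  exact: bump_operator_far al1 Swc.
Qed.
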